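(* Let $W$ be a nonempty set and let $\mathrm{Bel}$ be a function assigning a real number $\mathrm{Bel}(V|U)$ to each pair of subsets $U,V\subseteq W$ with $U\neq\emptyset$. Suppose there exist a set $W^+\supseteq W$ and a function $\mathrm{Bel}^+$, assigning a real number $\mathrm{Bel}^+(V|U)$ to each pair of subsets $U,V\subseteq W^+$ with $U\neq\emptyset$, which extends $\mathrm{Bel}$ (i.e. $\mathrm{Bel}^+(V|U)=\mathrm{Bel}(V|U)$ whenever $U,V\subseteq W$, $U\ne\emptyset$), together with functions $S:\mathbb{R}\to\mathbb{R}$ and $F:\mathbb{R}^2\to\mathbb{R}$, such that the following hold: (A1) $\mathrm{Bel}^+(\overline{V}|U)=S(\mathrm{Bel}^+(V|U))$ for all $U,V\subseteq W^+$ with $U\neq\emptyset$, where $\overline{V}=W^+\setminus V$; (A2) $\mathrm{Bel}^+(V\cap V'|U)=F(\mathrm{Bel}^+(V'|V\cap U),\mathrm{Bel}^+(V|U))$ for all $U,V,V'\subseteq W^+$ with $V\cap U\neq\emptyset$; (Par1) $\mathrm{Bel}^+$ takes values in $[0,1]$; (Par2) $\mathrm{Bel}^+(\emptyset|U)=0$ and $\mathrm{Bel}^+(U|U)=1$ for all $U\subseteq W^+$ with $U\neq\emptyset$; (Par3) $S$ is decreasing; (Par4) $F$ is continuous, and is strictly increasing in each coordinate on $(0,1]^2$; (Par5) for all $0\le\alpha,\beta,\gamma\le 1$ and $\epsilon>0$ there are sets $W^+\supseteq U_1\supseteq U_2\supseteq U_3\supseteq U_4$ with $U_3\neq\emptyset$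 such that each of $|\mathrm{Bel}^+(U_4|U_3)-\alpha|$, $|\mathrm{Bel}^+(U_3|U_2)-\beta|$ and $|\mathrm{Bel}^+(U_2|U_1)-\gamma|$ is less than $\epsilon$. Then $\mathrm{Bel}^+$ (and hence $\mathrm{Bel}$) is isomorphic to a probability measure.
   Context: For a function $B$ assigning a real number $B(V|U)$ to each pair of subsets $U,V$ of a set $X$ with $U\neq\emptyset$, write $B(U)$ for $B(U|X)$. Such a $B$ is *isomorphic to a probability measure* if there is a continuous one-to-one onto function $g:\mathbb{R}\to\mathbb{R}$ such that $g\circ B$, i.e. the map $U\mapsto g(B(U))$, is a probability measure on $X$, and $$g(B(V|U))\times g(B(U))=g(B(V\cap U))\quad\text{for all }U,V\subseteq X\text{ with }U\neq\emptyset.$$ In the claim this is applied to $B=\mathrm{Bel}^+$ with $X=W^+$, and to $B=\mathrm{Bel}$ with $X=W$. *)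

(* Defs.v *)
From mathcomp Require Import all_boot all_order all_algebra.
From mathcomp Require Import boolp classical_sets reals topology normedtype.

Set Implicit Arguments.
Unset Strict Implicit.
Unset Printing Implicit Defensive.

Import Order.TTheory GRing.Theory Num.Theory.
Import numFieldNormedType.Exports.

Local Open Scope classical_set_scope.
Local Open Scope ring_scope.

(* Belief functions are encoded as total functions B : set T -> set T -> R on
   the subsets of an ambient type T, with B V U standing for B(V|U).  Every
   condition on B over a set X of worlds is restricted to U, V `<=` X with
   U nonempty, so the values of B elsewhere are irrelevant. *)

(* A probability measure on the algebra of all subsets of X, in the finitely
   additive sense, since Cox's axioms cannot force countable additivity: on nat,
   let B(V|U) be the limit of |V & U & [0,n)| / |U & [0,n)| along a nonprincipal
   ultrafilter; then negation acts as x |-> 1 - x and conditioning as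
   multiplication, while every singleton has the same belief as set0. *)
Definition probability_on (T : Type) (R : realType) (X : set T)
    (P : set T -> R) : Prop :=
  [/\ forall U, U `<=` X -> 0 <= P U,
      P X = 1
    & forall U V, U `<=` X -> V `<=` X -> U `&` V = set0 ->
        P (U `|` V) = P U + P V].

Definition isomorphic_to_probability (T : Type) (R : realType) (X : set T)
    (B : set T -> set T -> R) : Prop :=
  exists g : R -> R,
    [/\ continuous g,
        bijective g,
        probability_on X (fun U => g (B U X))
      & forall U V, U `<=` X -> V `<=` X -> U !=set0 ->
          g (B V U) * g (B U X) = g (B (V `&` U) X)].

(* Main.v *)
(* The belief of a disjoint union is a function of the beliefs of its parts: if
   A and B are disjoint in U, then B has belief F(p, S(x)) and the complement of
   their union has belief F(S(p), S(x)), where x = Bel(A|U) and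
   p = Bel(B|U \ A).  This partial addition on [0, 1] is commutative,
   associative and cancellative, and x |-> F(x, z) distributes over it; each law
   holds for beliefs of sets, hence on a dense set of parameters by (Par5), hence
   everywhere, because the graph of the addition is compact.  A fixed point s of
   S is a half of 1, so F(s, s), F(s, F(s, s)), ... are halves of one another,
   and their multiples play the role of the dyadic numbers.  They yield an
   increasing homeomorphism g of [0, 1] that turns the partial addition into the
   ordinary one.  Every nonnegative additive function is a multiple of g; applied
   to x |-> g(F(x, z)) this gives g(F(x, z)) = g(x) g(z). *)

Require Import Defs.
From mathcomp Require Import all_boot all_order all_algebra.
From mathcomp Require Import boolp classical_sets reals topology normedtype.
From mathcomp Require Import lra.

Set Implicit Arguments.
Unset Strict Implicit.
Unset Printing Implicit Defensive.

Import Order.TTheory GRing.Theory Num.Theory.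
Import numFieldNormedType.Exports.

Local Open Scope classical_set_scope.
Local Open Scope ring_scope.

(** * Continuous real functions *)

Lemma continuous_pair_comp (T U V W : topologicalType) (f : T -> U) (g : T -> V)
    (F : U * V -> W) :
  continuous F -> continuous f -> continuous g ->
  continuous (fun t => F (f t, g t)).
Proof.
move=> cF cf cg x.
apply: (@continuous_comp _ _ _ (fun t => (f t, g t)) F); last exact: cF.
by apply: cvg_pair; [exact: cf | exact: cg].
Qed.

Section RealFunctions.
Variable R : realType.
Implicit Types (f phi psi : R -> R) (x y : R).

Lemma continuous_dist f x e : continuous f -> 0 < e ->
  exists2 d, 0 < d & forall y, `|x - y| < d -> `|f x - f y| < e.
Proof.
move=> cf e0; have := cf x; move/cvgrPdist_lt/(_ _ e0).
by rewrite -nbhs_ballE => -[d /= d0 dP]; exists d => // y xy; exact: (dP y).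
Qed.

(** If the inequality failed at 0, both functions would stay within half of the gap of their values
    at 0 for small positive [t]. This carries the monotonicity of [F] from (0, 1] to the
    boundary. *)
Lemma le_at0 phi psi : continuous phi -> continuous psi ->
  (forall t, 0 < t <= 1 -> phi t <= psi t) -> phi 0 <= psi 0.
Proof.
move=> cphi cpsi le_pp; rewrite leNgt; apply/negP => lt0.
have e0 : 0 < (phi 0 - psi 0) / 2 by lra.
have [d1 d10 d1P] := continuous_dist 0 cphi e0.
have [d2 d20 d2P] := continuous_dist 0 cpsi e0.
have [t [t0 t1 td1 td2]] : exists t, [/\ 0 < t, t <= 1, t < d1 & t < d2].
  exists (Num.min 1 (Num.min (d1 / 2) (d2 / 2))).
  by split; rewrite ?lt_min ?gt_min ?ge_min; lra.
have dt : `|0 - t| = t by rewrite sub0r normrN gtr0_norm.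
have := d1P t; have := d2P t; rewrite dt => /(_ td2) + /(_ td1).
by rewrite !ltr_norml; have := le_pp t; rewrite t0 t1 => /(_ isT); lra.
Qed.

Lemma IVT01 f v : continuous f -> f 0 <= v <= f 1 ->
  exists2 c, 0 <= c <= 1 & f c = v.
Proof.
move=> cf /andP[f0v vf1].
have fv : Num.min (f 0) (f 1) <= v <= Num.max (f 0) (f 1).
  by rewrite ge_min le_max f0v vf1 orbT.
have cf' : {within `[0, 1], continuous f} by exact: continuous_subspaceT.
have [c c01 fc] := IVT ler01 cf' fv.
by exists c => //; rewrite in_itv in c01.
Qed.

(* A monotone function can only fail to be continuous by jumping over an
   interval. *)
Lemma nondecreasing_dense_continuous f :
  (forall x y, x <= y -> f x <= f y) -> (forall x, 0 <= f x <= 1) ->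
  (forall u v, 0 <= u -> u < v -> v <= 1 -> exists x, u < f x < v) ->
  continuous f.
Proof.
move=> f_mono f01 f_dense x; apply/cvgrPdist_lt => e e0.
have right : exists2 d, 0 < d & forall y, y < x + d -> f y < f x + e.
  (* Above 1 the bound is automatic; otherwise [f] takes a value inside the interval at some [z],
     which monotonicity puts to the right of [x]. *)
  have [lt1|ge1] := ltP 1 (f x + e).
    by exists 1 => // y _; have := f01 y; lra.
  have [z /andP[xz ze]] : exists z, f x < f z < f x + e.
    by apply: f_dense; have := f01 x; lra.
  exists (z - x).
    by rewrite subr_gt0 ltNge; apply/negP => /f_mono; lra.
  by move=> y yz; apply: le_lt_trans ze; apply: f_mono; lra.
have left : exists2 d, 0 < d & forall y, x - d < y -> f x - e < f y.
  have [lt0|ge0] := ltP (f x - e) 0.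
    by exists 1 => // y _; have := f01 y; lra.
  have [z /andP[ze zx]] : exists z, f x - e < f z < f x.
    by apply: f_dense; have := f01 x; lra.
  exists (x - z).
    by rewrite subr_gt0 ltNge; apply/negP => /f_mono; lra.
  by move=> y yz; apply: (lt_le_trans ze); apply: f_mono; lra.
have [d1 d10 d1P] := right; have [d2 d20 d2P] := left.
apply/nbhs_ballP; exists (Num.min d1 d2) => /=; first by rewrite lt_min d10.
move=> y; rewrite /ball /= lt_min !ltr_norml => /andP[/andP[? ?] /andP[? ?]].
by have := d1P y; have := d2P y; lra.
Qed.

(** The negation [S] and the additive scale are controlled on [0, 1] only; composing them with this
    retraction gives well-behaved functions on the whole line. *)
Definition clamp x : R := Num.max 0 (Num.min 1 x).

Lemma clamp_continuous : continuous clamp.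
Proof.
move=> x; apply: (@max_fun_continuous _ R R (fun=> 0) (Num.min 1)) => {}x.
  exact: cvg_cst.
apply: (@min_fun_continuous _ R R (fun=> 1) id) => {}x; first exact: cvg_cst.
exact: cvg_id.
Qed.

Lemma clamp01 x : 0 <= clamp x <= 1.
Proof. by rewrite /clamp le_max lexx ge_max ler01 ge_min lexx. Qed.

Lemma clamp_id x : 0 <= x <= 1 -> clamp x = x.
Proof. by move=> /andP[x0 x1]; rewrite /clamp min_r// max_r. Qed.

Lemma clamp_le0 x : x <= 0 -> clamp x = 0.
Proof. by move=> x0; rewrite /clamp max_l// ge_min x0 orbT. Qed.

Lemma clamp_ge1 x : 1 <= x -> clamp x = 1.
Proof. by move=> x1; rewrite /clamp min_l// max_r. Qed.

(** The overshoot is 0 on [0, 1] and has slope 1 elsewhere. Unless [y <= 0] or [1 <= x], the left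
    side is at most 0 and the right side at least 0. *)
Lemma clamp_sub_le x y : x <= y -> x - clamp x <= y - clamp y.
Proof.
move=> xy; have /andP[? ?] := clamp01 x; have /andP[? ?] := clamp01 y.
have [y0|y0] := leP y 0; first by rewrite !clamp_le0; lra.
have [x1|x1] := leP 1 x; first by rewrite !clamp_ge1; lra.
have x_le : x <= clamp x.
  by have [?|?] := leP x 0; [rewrite clamp_le0 | rewrite clamp_id//; lra].
have y_le : clamp y <= y.
  by have [?|?] := leP 1 y; [rewrite clamp_ge1 | rewrite clamp_id//; lra].
lra.
Qed.

Lemma clamp_le x y : x <= y -> clamp x <= clamp y.
Proof.
by move=> xy; rewrite /clamp ge_max !le_max lexx /= le_min !ge_min lexx /= xy !orbT.
Qed.

Lemma compact_closed_image (T U : topologicalType) (f : T -> U) (A : set T) :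
  hausdorff_space U -> continuous f -> compact A -> closed (f @` A).
Proof.
move=> hU cf cA; apply: compact_closed => //.
by apply: continuous_compact => //; apply: continuous_subspaceT.
Qed.

Lemma closed_eq_continuous (T : topologicalType) (f g : T -> R) :
  continuous f -> continuous g -> closed [set t | f t = g t].
Proof.
move=> cf cg.
have -> : [set t | f t = g t] = (fun t => f t - g t) @^-1` [set 0].
  apply/seteqP; split=> t /=; first by move=> ->; rewrite subrr.
  by move/eqP; rewrite subr_eq0 => /eqP.
apply: preimage_closed => [t _|]; first by apply: cvgB; [exact: cf | exact: cg].
exact: closed_eq.
Qed.

Lemma continuous_affine x y : continuous (fun t : R => x + t * y).
Proof.
move=> t; apply: cvgD; first exact: cvg_cst.
by apply: cvgM; [exact: cvg_id | exact: cvg_cst].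
Qed.

End RealFunctions.

(** * Additive scales of a partial addition *)

Section Scale.
(** The partial operation is given by its graph [add]. The sequence [e] consists of successive
    halves of 1 that become arbitrarily small. *)
Variables (R : realType) (add : R -> R -> R -> Prop) (e : nat -> R).
Hypothesis add01 : forall x y w, add x y w ->
  [/\ 0 <= x <= 1, 0 <= y <= 1 & 0 <= w <= 1].
Hypothesis add_sym : forall x y w, add x y w -> add y x w.
Hypothesis add_fun : forall x y w w', add x y w -> add x y w' -> w = w'.
Hypothesis add_assoc : forall a b c bc v, add b c bc -> add a bc v ->
  exists ab, add a b ab /\ add ab c v.
Hypothesis add_zero : forall x, 0 <= x <= 1 -> add x 0 x.
Hypothesis add_gt : forall x y w, add x y w -> 0 < y -> x < w.
Hypothesis add_diff : forall x y, 0 <= x -> x <= y -> y <= 1 ->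
  exists d, add x d y.
Hypothesis e0 : e 0%N = 1.
Hypothesis eS : forall n, add (e n.+1) (e n.+1) (e n).
Hypothesis e_small : forall d, 0 < d -> exists n, e n < d.
Implicit Types (x y w u v : R) (n i j k : nat).

(** * Order properties of the partial addition *)

Lemma add_ge x y w : add x y w -> x <= w.
Proof.
move=> xyw; have [x01 /andP[y0 _] _] := add01 xyw.
move: y0; rewrite le_eqVlt => /predU1P[y0|/(add_gt xyw)/ltW//].
by rewrite -y0 in xyw; rewrite (add_fun xyw (add_zero x01)).
Qed.

Lemma add_assoc_sym a b c ab v : add a b ab -> add ab c v ->
  exists bc, add b c bc /\ add a bc v.
Proof.
move=> /add_sym abE /add_sym /(add_assoc abE)[bc [cb bca]].
by exists bc; split; exact: add_sym.
Qed.

(** Split [x] into [x'] and a difference [d]; regrouping the sum as [d] plus ([x'] plus [y]) shows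
    that the inner sum exists and is at most [w]. *)
Lemma add_shrink_left x x' y w : add x y w -> 0 <= x' -> x' <= x ->
  exists2 w', add x' y w' & w' <= w.
Proof.
move=> xyw x'0 x'x; have [/andP[_ x1] _ _] := add01 xyw.
have [d /add_sym x'd] := add_diff x'0 x'x x1.
have [w' [x'y /add_sym /add_ge w'w]] := add_assoc_sym x'd xyw.
by exists w'.
Qed.

Lemma add_shrink x x' y y' w :
  add x y w -> 0 <= x' -> x' <= x -> 0 <= y' -> y' <= y ->
  exists2 w', add x' y' w' & w' <= w.
Proof.
move=> xyw x'0 x'x y'0 y'y.
have [w1 /add_sym yx' w1w] := add_shrink_left xyw x'0 x'x.
have [w2 y'x' w2w1] := add_shrink_left yx' y'0 y'y.
by exists w2; [exact: add_sym | exact: le_trans w2w1 w1w].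
Qed.

(* The k-fold sum of [e n]; a junk value if k > 2 ^ n. *)
Fixpoint mult n k : R :=
  if n is n'.+1 then
    if odd k then xget 0 (add (mult n' k./2) (e n)) else mult n' k./2
  else k%:R.

Lemma mult_double n k : mult n.+1 k.*2 = mult n k.
Proof. by rewrite /= odd_double doubleK. Qed.

Lemma mult_doubleS n k :
  mult n.+1 k.*2.+1 = xget 0 (add (mult n k) (e n.+1)).
Proof. by rewrite /= odd_double uphalf_double. Qed.

Lemma mult0 n : mult n 0 = 0.
Proof. by elim: n => //= n; rewrite -{1}[0%N]/(0.*2) doubleK. Qed.

Lemma mult_full n : mult n (2 ^ n) = 1.
Proof. by elim: n => // n IHn; rewrite expnS mul2n mult_double. Qed.

(** Splitting [e n] into two copies of [e n.+1], associativity inserts a point [w] between the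
    multiples [j] and [j.+1] of [e n]. So the [xget] in [mult] finds a genuine sum, and both half
    steps follow. *)
Lemma mult_step n k : (k < 2 ^ n)%N -> add (mult n k) (e n) (mult n k.+1).
Proof.
elim: n k => [|n IHn] k.
  rewrite expn0 ltnS leqn0 => /eqP -> /=; rewrite e0.
  by apply: add_sym; apply: add_zero; rewrite ler01 lexx.
rewrite expnS mul2n -{1 2 3}[k]odd_double_half.
set j := k./2; move=> kn.
have jn : (j < 2 ^ n)%N.
  by rewrite -ltn_double; apply: leq_ltn_trans kn; apply: leq_addl.
have [w [jw wj]] := add_assoc (eS n) (IHn _ jn).
have jE : mult n.+1 j.*2.+1 = w.
  by rewrite mult_doubleS; apply/esym/(add_fun jw); apply: xgetPex; exists w.
case: (odd k); rewrite ?add1n ?add0n.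
  by rewrite jE -doubleS mult_double.
by rewrite jE mult_double.
Qed.

Lemma e_gt0 n : 0 < e n.
Proof.
elim: n => [|n IHn]; first by rewrite e0.
have [/andP[en _] _ _] := add01 (eS n).
rewrite lt_neqAle en andbT; apply/eqP => en0.
have := eS n; rewrite -en0 => /add_fun/(_ (add_zero _)).
by rewrite lexx ler01 => /(_ isT) en1; rewrite en1 ltxx in IHn.
Qed.

Lemma mult_lt n j k : (j < k)%N -> (k <= 2 ^ n)%N -> mult n j < mult n k.
Proof.
elim: k => // k IHk; rewrite ltnS leq_eqVlt => jk kn.
have lt_step := add_gt (mult_step kn) (e_gt0 n).
by case/predU1P: jk => [->//|jk]; apply: lt_trans lt_step; apply: IHk (ltnW kn).
Qed.

Lemma mult01 n k : (k <= 2 ^ n)%N -> 0 <= mult n k <= 1.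
Proof.
move=> kn; apply/andP; split.
  rewrite -(mult0 n); case: k kn => // k kn; exact/ltW/mult_lt.
rewrite -(mult_full n); move: kn; rewrite leq_eqVlt => /predU1P[->//|kn].
exact/ltW/mult_lt.
Qed.

Lemma mult1 n : mult n 1 = e n.
Proof.
have n0 : (0 < 2 ^ n)%N by rewrite expn_gt0.
have := mult_step n0; rewrite mult0 => /add_fun; apply.
by apply/add_sym/add_zero; have [] := add01 (eS n).
Qed.

Lemma mult_add n j k : (j + k <= 2 ^ n)%N ->
  add (mult n j) (mult n k) (mult n (j + k)).
Proof.
elim: k => [|k IHk] jk.
  by rewrite mult0 addn0; apply: add_zero; apply: mult01; rewrite addn0 in jk.
rewrite addnS in jk *.
have kn : (k < 2 ^ n)%N by apply: leq_ltn_trans jk; exact: leq_addl.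
have [w [kw jw]] := add_assoc_sym (IHk (ltnW jk)) (mult_step jk).
by rewrite (add_fun (mult_step kn) kw).
Qed.

Lemma mult_refine n i k : mult (i + n) (2 ^ i * k) = mult n k.
Proof.
elim: i => [|i IHi]; first by rewrite mul1n.
by rewrite addSn expnS -mulnA mul2n mult_double.
Qed.

(** Over the common denominator 2 ^ (n + n'), the contrapositive is strict monotonicity of the
    multiples at a single level. *)
Lemma mult_le_frac n k n' k' : (k <= 2 ^ n)%N -> (k' <= 2 ^ n')%N ->
  mult n k <= mult n' k' -> k%:R / (2 ^ n)%:R <= k'%:R / (2 ^ n')%:R :> R.
Proof.
move=> kn kn'; apply: contraTT; rewrite -!ltNge.
rewrite ltr_pdivrMr ?ltr0n ?expn_gt0// mulrAC ltr_pdivlMr ?ltr0n ?expn_gt0//.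
rewrite -!natrM ltr_nat => lt_frac.
rewrite -(mult_refine n n') -(mult_refine n' n) [(n + n')%N]addnC.
apply: mult_lt; first by rewrite mulnC [(_ * k)%N]mulnC.
by rewrite expnD leq_mul2l kn orbT.
Qed.

Lemma mult_bracket n x : 0 <= x <= 1 ->
  exists2 k, (k < 2 ^ n)%N & mult n k <= x <= mult n k.+1.
Proof.
move=> /andP[x0 x1].
have : forall K, (K < 2 ^ n)%N -> x <= mult n K.+1 ->
    exists2 k, (k < 2 ^ n)%N & mult n k <= x <= mult n k.+1.
  elim=> [|K IHK] Kn xK; first by exists 0%N => //; rewrite mult0 x0.
  have [xK'|/ltW Kx] := leP x (mult n K.+1); first exact: IHK (ltnW Kn) xK'.
  by exists K.+1; rewrite ?Kx.
move=> /(_ (2 ^ n).-1); rewrite prednK ?expn_gt0//; apply=> //.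
by rewrite mult_full.
Qed.

(** * Dyadic approximation and the additive scale *)

Lemma exists_pow2_gt (c : R) : exists n, c < (2 ^ n)%:R.
Proof.
exists (Num.truncn c).+1; apply: lt_trans (truncnS_gt c) _.
by rewrite ltr_nat ltn_expl.
Qed.

Lemma le_vanishing (a b c : R) :
  (forall n, a <= b + c / (2 ^ n)%:R) -> a <= b.
Proof.
move=> ab; rewrite leNgt; apply/negP => ba.
have [n] := exists_pow2_gt (c / (a - b)).
rewrite ltr_pdivrMr ?subr_gt0// mulrC -ltr_pdivrMr ?ltr0n ?expn_gt0//.
by have := ab n; lra.
Qed.

(** A Dedekind cut: the inverse of the map from the dyadic number k / 2 ^ n to [mult n k], extended
    by suprema. *)
Definition scale x : R :=
  sup [set r | exists n k, [/\ (k <= 2 ^ n)%N, mult n k <= x & r = k%:R / (2 ^ n)%:R]].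

Lemma frac_le1 n k : (k <= 2 ^ n)%N -> k%:R / (2 ^ n)%:R <= 1 :> R.
Proof. by move=> kn; rewrite ler_pdivrMr ?ltr0n ?expn_gt0// mul1r ler_nat. Qed.

Lemma scale_ge n k x : (k <= 2 ^ n)%N -> mult n k <= x ->
  k%:R / (2 ^ n)%:R <= scale x.
Proof.
move=> kn kx; apply: ub_le_sup; last by exists n, k.
by exists 1 => _ [m [i [im _ ->]]]; exact: frac_le1.
Qed.

Lemma scale_le n k x : 0 <= x -> (k <= 2 ^ n)%N -> x <= mult n k ->
  scale x <= k%:R / (2 ^ n)%:R.
Proof.
move=> x0 kn xk; apply: ge_sup.
  by exists 0, 0%N, 0%N; rewrite mul0r.
move=> _ [m [i [im ix ->]]]; apply: mult_le_frac => //; exact: le_trans xk.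
Qed.

Lemma scale_mult n k : (k <= 2 ^ n)%N -> scale (mult n k) = k%:R / (2 ^ n)%:R.
Proof.
move=> kn; have /andP[k0 _] := mult01 kn.
by apply/eqP; rewrite eq_le scale_le ?scale_ge.
Qed.

Lemma scale01 x : 0 <= x <= 1 -> 0 <= scale x <= 1.
Proof.
move=> /andP[x0 x1]; have := @scale_ge 0 0 x isT x0; have := @scale_le 0 1 x x0 isT x1.
by rewrite mul0r divr1 => -> ->.
Qed.

Lemma scale1 : scale 1 = 1.
Proof. by have := @scale_mult 0 1 isT; rewrite /= divr1. Qed.

Lemma scale_bracket n x : 0 <= x <= 1 -> exists k,
  [/\ (k < 2 ^ n)%N, mult n k <= x <= mult n k.+1
    & k%:R / (2 ^ n)%:R <= scale x <= k.+1%:R / (2 ^ n)%:R].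
Proof.
move=> x01; have /andP[x0 _] := x01.
have [k kn /andP[kx xk]] := mult_bracket n x01.
by exists k; rewrite kn kx xk (scale_ge (ltnW kn))// (scale_le x0 kn).
Qed.

(** Bracketing [x] and [y] between consecutive multiples of [e n] gives both inequalities up to an
    error 2 / 2 ^ n. *)
Lemma scale_add x y w : add x y w -> scale x + scale y = scale w.
Proof.
move=> xyw; have [x01 y01 w01] := add01 xyw.
apply/eqP; rewrite eq_le; apply/andP; split; apply: (@le_vanishing _ _ 2) => n.
all: have [j [jn /andP[jx xj] /andP[gj gj']]] := scale_bracket n x01.
all: have [k [kn /andP[ky yk] /andP[gk gk']]] := scale_bracket n y01.
all: have /andP[j0 _] := mult01 (ltnW jn).
all: have /andP[k0 _] := mult01 (ltnW kn).
- have [w' jkw' w'w] := add_shrink xyw j0 jx k0 ky.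
  (* Otherwise [mult n (2 ^ n - j)], which already completes [mult n j] to 1, is smaller than
     [mult n k], and the positive difference [d] pushes the sum above 1. *)
  have jk : (j + k <= 2 ^ n)%N.
    rewrite leqNgt; apply/negP => lt_jk.
    have jj : (2 ^ n - j < k)%N by rewrite ltn_subLR// ltnW.
    have /andP[j'0 _] := mult01 (leq_subr j (2 ^ n)).
    have /andP[_ k1] := mult01 (ltnW kn).
    have [d jjd] := add_diff j'0 (ltW (mult_lt jj (ltnW kn))) k1.
    have [a [ja ad]] := add_assoc jjd jkw'.
    have := @mult_add n j (2 ^ n - j); rewrite subnKC ?(ltnW jn)// mult_full.
    move=> /(_ (leqnn _)) /(add_fun ja) a1.
    have [_ /andP[d0 _] /andP[_ w'1]] := add01 ad.
    have dgt0 : 0 < d.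
      rewrite lt_neqAle d0 andbT; apply/eqP => dE; move: jjd (mult_lt jj (ltnW kn)).
      rewrite -dE => /add_fun/(_ (add_zero (mult01 (leq_subr j (2 ^ n))))) ->.
      by rewrite ltxx.
    by have := add_gt ad dgt0; rewrite a1; lra.
  rewrite (add_fun jkw' (mult_add jk)) in w'w.
  have := scale_ge jk w'w; rewrite natrD -natr1 in gj' *.
  rewrite -natr1 in gk'.
  rewrite !mulrDl in gj' gk' *; lra.
(* When the upper multiples have no sum, their fractions add up to more than 1, which bounds
   [scale w] anyway. *)
- have [jk|jk] := leqP (j.+1 + k.+1) (2 ^ n).
    have /andP[x0 _] := x01; have /andP[y0 _] := y01; have /andP[w0 _] := w01.
    have [w' xyw' w'w] := add_shrink (mult_add jk) x0 xj y0 yk.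
    rewrite (add_fun xyw' xyw) in w'w.
    have := scale_le w0 jk w'w; rewrite natrD -!natr1 !mulrDl; lra.
  have /andP[_ w1] := scale01 w01.
  have : 1 <= (j.+1 + k.+1)%:R / (2 ^ n)%:R :> R.
    by rewrite ler_pdivlMr ?ltr0n ?expn_gt0// mul1r ler_nat ltnW.
  rewrite natrD -!natr1 !mulrDl; lra.
Qed.

(** The difference of [y] and [x] exceeds some [e n], so its scale is at least 1 / 2 ^ n. *)
Lemma scale_lt x y : 0 <= x -> x < y -> y <= 1 -> scale x < scale y.
Proof.
move=> x0 xy y1; have [d xdy] := add_diff x0 (ltW xy) y1.
have [x01 /andP[d0 d1] _] := add01 xdy.
have dgt0 : 0 < d.
  rewrite lt_neqAle d0 andbT; apply/eqP => dE; move: xdy xy; rewrite -dE.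
  by move=> /add_fun/(_ (add_zero x01)) ->; rewrite ltxx.
have [n nd] := e_small dgt0.
have := @scale_ge n 1 d; rewrite expn_gt0 mult1 => /(_ isT (ltW nd)).
have : 0 < 1%:R / (2 ^ n)%:R :> R by rewrite divr_gt0// ltr0n ?expn_gt0.
rewrite -(scale_add xdy); lra.
Qed.

Lemma scale_dense u v : 0 <= u -> u < v -> v <= 1 ->
  exists2 x, 0 <= x <= 1 & u < scale x < v.
Proof.
(* On a dyadic grid of mesh less than [v - u], the first point beyond [u] is still below [v]. *)
move=> u0 uv v1; have [n] := exists_pow2_gt (v - u)^-1.
set N := (2 ^ n)%:R; have N0 : 0 < N :> R by rewrite ltr0n expn_gt0.
rewrite -div1r ltr_pdivrMr ?subr_gt0// mulrBr => uvN.
have := truncn_itv (mulr_ge0 u0 (ltW N0)); set k := Num.truncn _.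
rewrite -natr1 => /andP[ku uk].
have kv : k.+1%:R < v * N by rewrite -natr1; lra.
have kn : (k.+1 <= 2 ^ n)%N.
  rewrite -(ler_nat R) (le_trans (ltW kv))// -[leRHS]mul1r.
  by rewrite ler_wpM2r// ltW.
exists (mult n k.+1); first exact: mult01.
by rewrite scale_mult// ltr_pdivlMr// ltr_pdivrMr// kv -natr1 uk.
Qed.

(** Additivity determines [h] on the multiples of [e n]; nonnegativity makes [h] monotone, which
    squeezes it between consecutive multiples. *)
Lemma additive_scale (h : R -> R) :
  (forall x, 0 <= x <= 1 -> 0 <= h x) ->
  (forall x y w, add x y w -> h x + h y = h w) ->
  forall x, 0 <= x <= 1 -> h x = scale x * h 1.
Proof.
move=> h0 hD.
have h_mult n k : (k <= 2 ^ n)%N -> h (mult n k) = k%:R * h (e n).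
  elim: k => [|k IHk] kn.
    have /hD := @mult_add n 0 0 isT; rewrite mult0 mul0r; lra.
  by rewrite -(hD _ _ _ (mult_step kn)) IHk 1?ltnW// -natr1 mulrDl mul1r.
have h_e n : h (e n) = h 1 / (2 ^ n)%:R.
  have := h_mult n _ (leqnn _); rewrite mult_full => ->.
  by rewrite mulrAC divff ?mul1r// pnatr_eq0 -lt0n expn_gt0.
have h_le x y : 0 <= x -> x <= y -> y <= 1 -> h x <= h y.
  move=> x0 xy y1; have [d xd] := add_diff x0 xy y1.
  by have [_ /h0 ? _] := add01 xd; rewrite -(hD _ _ _ xd) lerDl.
move=> x x01; have h1 : 0 <= h 1 by apply: h0; rewrite ler01 lexx.
have /andP[x0 x1] := x01.
apply/eqP; rewrite eq_le; apply/andP; split; apply: (@le_vanishing _ _ (h 1)) => n.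
all: have [k [kn /andP[kx xk] /andP[gk gk']]] := scale_bracket n x01.
all: have /andP[k0 _] := mult01 (ltnW kn).
all: have /andP[_ k1] := mult01 kn.
all: have := h_le _ _ x0 xk k1; have := h_le _ _ k0 kx x1.
all: rewrite !h_mult ?(ltnW kn)// h_e.
all: have := ler_wpM2r h1 gk; have := ler_wpM2r h1 gk'.
all: rewrite -!natr1 mulrDl !mul1r !mulrDl; rewrite ![_ * (_ / _)]mulrA.
all: rewrite ![_ * _ / _]mulrAC; lra.
Qed.

Lemma scale_exists : exists h : R -> R,
  [/\ (forall x, 0 <= x <= 1 -> 0 <= h x <= 1) /\ h 1 = 1,
      forall x y w, add x y w -> h x + h y = h w,
      forall x y, 0 <= x -> x < y -> y <= 1 -> h x < h y,
      forall u v, 0 <= u -> u < v -> v <= 1 ->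
        exists2 x, 0 <= x <= 1 & u < h x < v
    & forall k : R -> R, (forall x, 0 <= x <= 1 -> 0 <= k x) ->
        (forall x y w, add x y w -> k x + k y = k w) ->
        forall x, 0 <= x <= 1 -> k x = h x * k 1].
Proof.
exists scale; split.
- by split; [exact: scale01 | exact: scale1].
- exact: scale_add.
- exact: scale_lt.
- exact: scale_dense.
- exact: additive_scale.
Qed.

End Scale.

(** * The partial addition of beliefs *)

Section ConjunctionNegation.
Variables (R : realType) (F : R * R -> R) (N : R -> R).

(* [N x] is the belief of the complement U \ A of an event A of belief [x], and
   [p] the belief of a disjoint event B conditional on U \ A; then [y] and [w]
   are the beliefs of B and of the union of A and B. *)
Definition disjoint_sum x y w := exists p,
  [/\ 0 <= x <= 1, 0 <= p <= 1, y = F (p, N x) & w = N (F (N p, N x))].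

Hypothesis F_continuous : continuous F.
Hypothesis N_continuous : continuous N.

(** The graph is the continuous image of the compact square of pairs [(x, p)]. *)
Lemma disjoint_sum_closed :
  closed [set t : R * R * R | disjoint_sum t.1.1 t.1.2 t.2].
Proof.
pose f (q : R * R) := ((q.1, F (q.2, N q.1)), N (F (N q.2, N q.1))).
have -> : [set t : R * R * R | disjoint_sum t.1.1 t.1.2 t.2] =
    f @` (`[0, 1] `*` `[0, 1]).
  rewrite eqEsubset; split=> [[[x y] w] /= [p [x01 p01 -> ->]]|].
    by exists (x, p) => //; split; rewrite /= in_itv.
  move=> _ [[x p] [/= x01 p01] <-]; exists p.
  by rewrite /= !in_itv in x01 p01.
apply: compact_closed_image; first exact: norm_hausdorff.
  have c1 : continuous (fun q : R * R => q.1) by move=> q; exact: cvg_fst.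
  have c2 : continuous (fun q : R * R => q.2) by move=> q; exact: cvg_snd.
  have cN1 : continuous (fun q : R * R => N q.1).
    by move=> q; apply: (@continuous_comp _ _ _ _ N); [exact: c1 | exact: N_continuous].
  have cN2 : continuous (fun q : R * R => N q.2).
    by move=> q; apply: (@continuous_comp _ _ _ _ N); [exact: c2 | exact: N_continuous].
  have cF : continuous (fun q : R * R => F (q.2, N q.1)).
    exact: continuous_pair_comp.
  have cFN : continuous (fun q : R * R => N (F (N q.2, N q.1))).
    move=> q; apply: (@continuous_comp _ _ _ (fun q : R * R => F (N q.2, N q.1)) N).
      exact: continuous_pair_comp.
    exact: N_continuous.
  apply: (@continuous_pair_comp _ _ _ _ _ _ id) => //; first by move=> q; exact: cvg_id.
  by apply: (@continuous_pair_comp _ _ _ _ _ _ id) => //; move=> q; exact: cvg_id.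
by apply: compact_setX; exact: segment_compact.
Qed.

Hypothesis F_le : forall x x' y y', 0 <= x -> x <= x' -> x' <= 1 ->
  0 <= y -> y <= y' -> y' <= 1 -> F (x, y) <= F (x', y').
Hypothesis F_lt : forall x x' y, 0 <= x -> x < x' -> x' <= 1 ->
  0 < y <= 1 -> F (x, y) < F (x', y).
Hypothesis F1y : forall y, 0 <= y <= 1 -> F (1, y) = y.
Hypothesis F0y : forall y, 0 <= y <= 1 -> F (0, y) = 0.
Hypothesis N01 : forall x, 0 <= N x <= 1.
Hypothesis N_le : forall x y, x <= y -> N y <= N x.
Hypothesis NK : forall x, 0 <= x <= 1 -> N (N x) = x.
Hypothesis N0 : N 0 = 1.
Hypothesis N1 : N 1 = 0.
(** The three laws are stated in the parameters of a chain of sets U1, U2, U3, U4: [alpha], [beta]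
    and [gamma] stand for the beliefs of U4 in U3, of U3 in U2 and of U2 in U1. In this form they
    pass to limits. *)
Hypothesis sum_sym_law : forall beta gamma,
  0 <= beta <= 1 -> 0 <= gamma <= 1 ->
  disjoint_sum (F (beta, gamma)) (N gamma) (N (F (N beta, gamma))).
Hypothesis sum_assoc_law : forall alpha beta gamma,
  0 <= alpha <= 1 -> 0 <= beta <= 1 -> 0 <= gamma <= 1 ->
  disjoint_sum (N (F (beta, gamma))) (F (F (alpha, beta), gamma))
    (N (F (F (N alpha, beta), gamma))) /\
  disjoint_sum (N gamma) (F (N (F (N alpha, beta)), gamma))
    (N (F (F (N alpha, beta), gamma))).
Hypothesis sum_dist_law : forall alpha beta gamma,
  0 <= alpha <= 1 -> 0 <= beta <= 1 -> 0 <= gamma <= 1 ->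
  disjoint_sum (F (N beta, gamma)) (F (F (alpha, beta), gamma))
    (F (N (F (N alpha, beta)), gamma)).

Implicit Types (x y z p w : R).

(** * Conjunction and negation on the unit interval *)

Lemma F01 x y : 0 <= x <= 1 -> 0 <= y <= 1 -> 0 <= F (x, y) <= y.
Proof.
move=> /andP[x0 x1] y01; have /andP[y0 y1] := y01.
have := F_le (lexx 0) x0 x1 y0 (lexx y) y1; rewrite F0y// => -> /=.
by have := F_le x0 x1 (lexx 1) y0 (lexx y) y1; rewrite F1y.
Qed.

Lemma F01' x y : 0 <= x <= 1 -> 0 <= y <= 1 -> 0 <= F (x, y) <= 1.
Proof.
move=> x01 y01; have /andP[-> /le_trans] := F01 x01 y01.
by apply; case/andP: y01.
Qed.

Lemma Fx0 x : 0 <= x <= 1 -> F (x, 0) = 0.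
Proof.
move=> x01; apply/eqP; rewrite eq_le andbC; apply: F01 => //.
by rewrite lexx ler01.
Qed.

Lemma N_lt x y : 0 <= x -> x < y -> y <= 1 -> N y < N x.
Proof.
move=> x0 xy y1; rewrite lt_neqAle N_le ?(ltW xy)// andbT; apply/eqP => Nxy.
have x01 : 0 <= x <= 1 by rewrite x0 (le_trans (ltW xy)).
have y01 : 0 <= y <= 1 by rewrite y1 (le_trans x0 (ltW xy)).
by have := NK x01; rewrite -Nxy NK// => yx; rewrite yx ltxx in xy.
Qed.

Lemma F_section_continuous y : continuous (fun p => F (p, y)).
Proof.
apply: continuous_pair_comp => //; first by move=> x; exact: cvg_id.
by move=> x; exact: cvg_cst.
Qed.

Lemma F_solve y z : 0 <= y <= z -> z <= 1 ->
  exists2 p, 0 <= p <= 1 & F (p, z) = y.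
Proof.
move=> /andP[y0 yz] z1.
apply: (IVT01 (f := fun p => F (p, z))); first exact: F_section_continuous.
by rewrite F0y ?F1y ?y0 ?yz ?z1 ?(le_trans y0 yz).
Qed.

(** * Algebraic laws of the addition of disjoint beliefs *)

Lemma sum01 x y w : disjoint_sum x y w ->
  [/\ 0 <= x <= 1, 0 <= y <= 1 & 0 <= w <= 1].
Proof. by move=> [p [x01 p01 -> ->]]; split=> //; exact: F01'. Qed.

Lemma sum_intro x p : 0 <= x <= 1 -> 0 <= p <= 1 ->
  disjoint_sum x (F (p, N x)) (N (F (N p, N x))).
Proof. by move=> x01 p01; exists p. Qed.

Lemma sum_sym x y w : disjoint_sum x y w -> disjoint_sum y x w.
Proof.
move=> [p [x01 p01 -> ->]]; have := sum_sym_law p01 (N01 x).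
by rewrite NK.
Qed.

(** A larger summand comes from a larger conditional belief, and its existence forces [N x] to be
    positive, so that [F] is strict in its first argument. *)
Lemma sum_lt x y y' w w' : disjoint_sum x y w -> disjoint_sum x y' w' ->
  y < y' -> w < w'.
Proof.
move=> [p [x01 p01 -> ->]] [q [_ q01 -> ->]] lt_pq.
have /andP[q0 q1] := q01; have /andP[p0 p1] := p01.
have /andP[x'0 x'1] := N01 x.
have pq : p < q by rewrite ltNge; apply: contraTN lt_pq => ?; rewrite -leNgt F_le.
have Nx0 : 0 < N x.
  rewrite (le_lt_trans _ (lt_le_trans lt_pq _))//.
    by have /andP[] := F01 p01 (N01 x).
  by have /andP[] := F01 q01 (N01 x).
have /andP[Nq0 _] := N01 q; have /andP[_ Np1] := N01 p.
have Nlt := N_lt p0 pq q1.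
have /andP[Fq0 _] := F01' (N01 q) (N01 x); have /andP[_ Fp1] := F01' (N01 p) (N01 x).
by apply: N_lt => //; apply: F_lt => //; rewrite Nx0.
Qed.

(** The conditional belief [p] is determined by [y] unless [N x] is 0, and then [w] is [N 0]
    whatever [p] is. *)
Lemma sum_fun x y w w' :
  disjoint_sum x y w -> disjoint_sum x y w' -> w = w'.
Proof.
move=> [p [x01 p01 -> ->]] [q [_ q01 + ->]].
have /andP[q0 q1] := q01; have /andP[p0 p1] := p01.
have /andP[] := N01 x; rewrite le_eqVlt => /predU1P[<- _ _|Nx0 Nx1 Fpq].
  by rewrite !Fx0 ?N01.
have Nx : 0 < N x <= 1 by rewrite Nx0.
have [pq|qp|->//] := ltgtP p q.
  by have := F_lt p0 pq q1 Nx; rewrite Fpq ltxx.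
by have := F_lt q0 qp p1 Nx; rewrite Fpq ltxx.
Qed.

Lemma sum_zero x : 0 <= x <= 1 -> disjoint_sum x 0 x.
Proof.
move=> x01; have := sum_intro (p := 0) x01; rewrite lexx ler01 => /(_ isT).
by rewrite F0y ?N01// N0 F1y ?N01// NK.
Qed.

Lemma sum_compl x : 0 <= x <= 1 -> disjoint_sum x (N x) 1.
Proof.
move=> x01; have := sum_intro (p := 1) x01; rewrite lexx ler01 => /(_ isT).
by rewrite F1y ?N01// N1 F0y ?N01// N0.
Qed.

Lemma sum_gt x y w : disjoint_sum x y w -> 0 < y -> x < w.
Proof.
by move=> xyw y0; have [x01 _ _] := sum01 xyw; exact: sum_lt (sum_zero x01) xyw y0.
Qed.

Lemma sum_ge x y w : disjoint_sum x y w -> x <= w.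
Proof.
move=> xyw; have [x01 /andP[] ] := sum01 xyw.
rewrite le_eqVlt => /predU1P[y0|y0] _ _; last exact: ltW (sum_gt xyw y0).
by rewrite -y0 in xyw; rewrite (sum_fun xyw (sum_zero x01)).
Qed.

Lemma sum_diff x y : 0 <= x -> x <= y -> y <= 1 ->
  exists d, disjoint_sum x d y.
Proof.
move=> x0 xy y1; have x01 : 0 <= x <= 1 by rewrite x0 (le_trans xy).
have Nx01 := N01 x; have /andP[Nx0 Nx1] := Nx01.
(* The complement of the larger event lies in that of the smaller one; [q] is its conditional belief
   there, and [N q] that of the difference. *)
have [q q01 Fq] : exists2 q, 0 <= q <= 1 & F (q, N x) = N y.
  by apply: F_solve => //; have /andP[-> _] := N01 y; exact: N_le.
exists (F (N q, N x)); exists (N q); split=> //.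
by rewrite NK// Fq NK// y1 (le_trans x0).
Qed.

Lemma sum_le_compl x y w : disjoint_sum x y w -> y <= N x.
Proof. by move=> [p [x01 p01 -> _]]; have /andP[] := F01 p01 (N01 x). Qed.

(** Distributivity in the usual form: [sum_dist_law] at [p], [N x] and [z]. *)
Lemma sum_scaled x y w z : 0 <= z <= 1 -> disjoint_sum x y w ->
  disjoint_sum (F (x, z)) (F (y, z)) (F (w, z)).
Proof.
move=> z01 [p [x01 p01 -> ->]]; have := sum_dist_law p01 (N01 x) z01.
by rewrite NK.
Qed.

(* Writing a, b, c as consecutive differences of a chain U1, U2, U3, U4 amounts
   to solving for the conditional beliefs [gamma], [beta], [alpha] of its
   steps. *)
Lemma sum_assoc a b c bc v : disjoint_sum b c bc -> disjoint_sum a bc v ->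
  exists ab, disjoint_sum a b ab /\ disjoint_sum ab c v.
Proof.
move=> bc_sum av_sum; set gamma := N a.
have [b01 c01 bc01] := sum01 bc_sum; have [a01 _ _] := sum01 av_sum.
have gamma01 : 0 <= gamma <= 1 := N01 a; have /andP[gamma0 gamma1] := gamma01.
have bc_gamma := sum_le_compl av_sum.
(* In the chain, [a] belongs to the complement of U2, whose own belief is therefore [gamma]; [q] is
   the conditional belief of the part of belief [b] in U2. *)
have [q q01 qb] : exists2 q, 0 <= q <= 1 & F (q, gamma) = b.
  by apply: F_solve gamma1; case/andP: b01 => -> _; rewrite (le_trans (sum_ge bc_sum)).
set beta := N q; have beta01 : 0 <= beta <= 1 := N01 q.
have NbetaE : N beta = q by exact: NK.
(* In U2, [b] and the remainder of belief [F (beta, gamma)] add up to [gamma]. If [c] exceeded this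
   remainder, [bc] would exceed [gamma]. *)
have bd_sum : disjoint_sum b (F (beta, gamma)) gamma.
  by have := sum_scaled gamma01 (sum_compl q01); rewrite qb F1y.
have c_le : c <= F (beta, gamma).
  rewrite leNgt; apply/negP => /(sum_lt bd_sum bc_sum).
  by rewrite ltNge bc_gamma.
have [alpha alpha01 alphaE] : exists2 p, 0 <= p <= 1 & F (F (p, beta), gamma) = c.
  apply: (IVT01 (f := fun p => F (F (p, beta), gamma))).
    apply: continuous_pair_comp => //; first exact: F_section_continuous.
    by move=> x; exact: cvg_cst.
  by rewrite F0y// F0y// F1y// c_le; case/andP: c01 => ->.
have [] := sum_assoc_law alpha01 beta01 gamma01.
have := sum_dist_law alpha01 beta01 gamma01.
rewrite NbetaE qb alphaE => /(sum_fun bc_sum) <-.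
rewrite /gamma NK// -/gamma => abc /(sum_fun av_sum) vE.
(* The belief of the complement of U3, which unites the parts of beliefs [a] and [b]. *)
exists (N (F (beta, gamma))); rewrite vE; split=> //.
by rewrite -{1}qb; exact: sum_intro.
Qed.

(** * Halving and the rescaling of beliefs *)

Lemma half_exists : exists2 s, 0 <= s <= 1 & N s = s.
Proof.
(* The difference [x - N x] runs from -1 at 0 to 1 at 1. *)
have [||s s01 s_fix] := @IVT01 R (fun x => x - N x) 0.
- by move=> x; apply: cvgB; [exact: cvg_id | exact: N_continuous].
- by rewrite N0 N1; lra.
by exists s => //; lra.
Qed.

Lemma probability_scale_exists : exists g : R -> R,
  [/\ continuous g, bijective g,
      (forall x, 0 <= x <= 1 -> 0 <= g x) /\ g 1 = 1,
      forall x y, 0 <= x <= 1 -> 0 <= y <= 1 -> g (F (x, y)) = g x * g y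
    & forall x y w, disjoint_sum x y w -> g x + g y = g w].
Proof.
have [s s01 Ns] := half_exists; have /andP[s0 s1] := s01.
have s_lt1 : s < 1.
  by rewrite lt_neqAle s1 andbT; apply/eqP => s1E; move: Ns; rewrite s1E N1; lra.
pose e n := iter n (fun x => F (s, x)) 1.
have e0 : e 0%N = 1 by [].
have e01 n : 0 <= e n <= 1.
  by elim: n => [|n IHn]; [rewrite /e/= ler01 lexx | exact: F01'].
have half_sum : disjoint_sum s s 1 by rewrite -{2}Ns; exact: sum_compl.
(* Scaling the sum of [s] and [s], which is 1, by [e n] exhibits [e n.+1] as a half of [F (1, e n)],
   that is, of [e n]. *)
have eS n : disjoint_sum (e n.+1) (e n.+1) (e n).
  by rewrite -(F1y (e01 n)); exact: sum_scaled.
have e_small d : 0 < d -> exists n, e n < d.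
  move=> d0; apply: contrapT => /forallNP e_ge.
  have inf_e : has_inf (range e).
    by split; [exists (e 0%N), 0%N | exists 0 => _ [n _ <-]; case/andP: (e01 n)].
  (* A positive infimum [t] would satisfy [F (s, t) < F (1, t) = t]; by continuity, an [e n] close
     to [t] would then have its half [e n.+1] below [t]. *)
  set t := inf (range e).
  have t_le n : t <= e n by apply: ge_inf; [case: inf_e | exists n].
  have d_t : d <= t.
    apply: lb_le_inf; first by case: inf_e.
    by move=> _ [n _ <-]; rewrite leNgt; apply/negP.
  have t01 : 0 < t <= 1 by rewrite (lt_le_trans d0 d_t)/= (t_le 0%N).
  have Fst : F (s, t) < t.
    by have := F_lt s0 s_lt1 (lexx 1) t01; rewrite F1y//; lra.
  have cFs : continuous (fun x => F (s, x)).
    apply: continuous_pair_comp => //; first by move=> x; exact: cvg_cst.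
    by move=> x; exact: cvg_id.
  have gap : 0 < t - F (s, t) by rewrite subr_gt0.
  have [r r0 rP] := continuous_dist t cFs gap.
  have [_ [n _ <-] en] := inf_adherent r0 inf_e.
  have : `|t - e n| < r by rewrite ltr_norml; have := t_le n; lra.
  by move=> /rP; rewrite ltr_norml; have := t_le n.+1; rewrite /=; lra.
have [h [[h01 h1] hD hlt hdense huniq]] := scale_exists sum01 sum_sym sum_fun
  sum_assoc sum_zero sum_gt sum_diff e0 eS e_small.
have h0 : h 0 = 0.
  have /hD : disjoint_sum 0 0 0 by apply: sum_zero; rewrite lexx ler01.
  lra.
have hc_le x y : x <= y -> h (clamp x) <= h (clamp y).
  move=> /clamp_le; rewrite le_eqVlt => /predU1P[->//|lt_xy].
  have /andP[cx0 _] := clamp01 x; have /andP[_ cy1] := clamp01 y.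
  exact/ltW/hlt.
have hc_cont : continuous (h \o @clamp R).
  apply: nondecreasing_dense_continuous => //.
    by move=> x; apply: h01; exact: clamp01.
  move=> u v u0 uv v1; have [x x01 uxv] := hdense _ _ u0 uv v1.
  by exists x; rewrite /= clamp_id.
(* Since [h] fixes 0 and 1, this extends [h] from [0, 1] by the identity outside, giving an
   increasing bijection of the line. *)
pose g x := h (clamp x) + (x - clamp x).
have gE x : 0 <= x <= 1 -> g x = h x.
  by move=> x01; rewrite /g clamp_id// subrr addr0.
have g_lt x y : x < y -> g x < g y.
  move=> xy; have := clamp_le (ltW xy); rewrite /g le_eqVlt => /predU1P[->|lt_c].
    by rewrite ltrD2l ltrD2r.
  have /andP[cx0 _] := clamp01 x; have /andP[_ cy1] := clamp01 y.
  by have := hlt _ _ cx0 lt_c cy1; have := clamp_sub_le (ltW xy); lra.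
have g_surj v : exists x, g x = v.
  have [v0|v0] := ltP v 0.
    by exists v; rewrite /g clamp_le0 ?h0; lra.
  have [v1|v1] := ltP 1 v.
    by exists v; rewrite /g clamp_ge1 ?h1; lra.
  have [|x x01 <-] := IVT01 (v := v) hc_cont.
    by rewrite /= !clamp_id ?h0 ?h1 ?v0 ?v1 ?lexx ?ler01.
  by exists x; rewrite gE //= clamp_id.
exists g; split.
- move=> x; apply: cvgD; first exact: hc_cont.
  by apply: cvgB; [exact: cvg_id | exact: clamp_continuous].
- have [k gk] := choice g_surj; exists k => // x.
  by have := gk (g x); case: (ltgtP (k (g x)) x) => // /g_lt; lra.
- by split=> [x x01|]; rewrite gE ?h1 ?ler01 ?lexx//; case/andP: (h01 x x01).
- move=> x y x01 y01; rewrite !gE//; last exact: F01'.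
  (* At 1 this additive function takes the value [h y], because [F (1, y) = y]. *)
  rewrite (huniq (fun z => h (F (z, y))))// ?F1y//.
    by move=> z z01; case/andP: (h01 _ (F01' z01 y01)).
  by move=> z z' w zz'; apply: hD; exact: sum_scaled.
- by move=> x y w xyw; have [x01 y01 w01] := sum01 xyw; rewrite !gE// (hD _ _ _ xyw).
Qed.

End ConjunctionNegation.

(** * Beliefs of sets *)

Section Belief.
Variables (R : realType) (T : Type) (X : set T) (Bel : set T -> set T -> R).
Variables (S : R -> R) (F : R * R -> R).
Hypothesis X_neq0 : X !=set0.
Hypothesis Bel_compl : forall U V, U `<=` X -> V `<=` X -> U !=set0 ->
  Bel (X `\` V) U = S (Bel V U).
Hypothesis Bel_conj : forall U V V', U `<=` X -> V `<=` X -> V' `<=` X ->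
  V `&` U !=set0 -> Bel (V `&` V') U = F (Bel V' (V `&` U), Bel V U).
Hypothesis Bel01 : forall U V, U `<=` X -> V `<=` X -> U !=set0 ->
  0 <= Bel V U <= 1.
Hypothesis Bel_bounds : forall U, U `<=` X -> U !=set0 ->
  Bel set0 U = 0 /\ Bel U U = 1.
Hypothesis S_decreasing : forall x y, x <= y -> S y <= S x.
Hypothesis F_continuous : continuous F.
Hypothesis F_increasing1 : forall x x' y, 0 < x <= 1 -> 0 < x' <= 1 ->
  0 < y <= 1 -> x < x' -> F (x, y) < F (x', y).
Hypothesis F_increasing2 : forall x y y', 0 < x <= 1 -> 0 < y <= 1 ->
  0 < y' <= 1 -> y < y' -> F (x, y) < F (x, y').
Hypothesis chains : forall alpha beta gamma epsilon : R,
  0 <= alpha <= 1 -> 0 <= beta <= 1 -> 0 <= gamma <= 1 -> 0 < epsilon ->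
  exists U1 U2 U3 U4 : set T,
    [/\ U1 `<=` X, U2 `<=` U1, U3 `<=` U2 & U4 `<=` U3] /\
    [/\ U3 !=set0,
        `|Bel U4 U3 - alpha| < epsilon,
        `|Bel U3 U2 - beta| < epsilon
      & `|Bel U2 U1 - gamma| < epsilon].
Implicit Types (A B U V : set T) (x y : R).

(** The transfer principle: by [chains] the beliefs along chains of sets are dense in the unit cube,
    so a closed condition only has to be checked on them. *)
Lemma closed_chain (C : set (R * R * R)) : closed C ->
  (forall U1 U2 U3 U4, U1 `<=` X -> U2 `<=` U1 -> U3 `<=` U2 -> U4 `<=` U3 ->
    U3 !=set0 -> C (Bel U4 U3, Bel U3 U2, Bel U2 U1)) ->
  forall alpha beta gamma, 0 <= alpha <= 1 -> 0 <= beta <= 1 ->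
    0 <= gamma <= 1 -> C (alpha, beta, gamma).
Proof.
move=> clC chC a b c a01 b01 c01; apply: clC => B /nbhs_ballP[e /= e0 eB].
have [U1 [U2 [U3 [U4 [[? ? ? ?] [? ? ? ?]]]]]] := chains a01 b01 c01 e0.
exists (Bel U4 U3, Bel U3 U2, Bel U2 U1); split; first exact: chC.
by apply: eB; split; [split|]; rewrite /ball /= distrC.
Qed.

(** Moving both points towards (1, 1) by a factor [t] brings them into the region where [F] is known
    to increase; then [t] tends to 0. *)
Lemma F_le x x' y y' : 0 <= x -> x <= x' -> x' <= 1 ->
  0 <= y -> y <= y' -> y' <= 1 -> F (x, y) <= F (x', y').
Proof.
move=> x0 xx' x'1 y0 yy' y'1.
have := @le_at0 _ (fun t => F (x + t * (1 - x), y + t * (1 - y)))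
  (fun t => F (x' + t * (1 - x'), y' + t * (1 - y'))).
rewrite !mul0r !addr0; apply.
- by apply: continuous_pair_comp => //; exact: continuous_affine.
- by apply: continuous_pair_comp => //; exact: continuous_affine.
move=> t /andP[t0 t1].
have pos z : 0 <= z -> z <= 1 -> 0 < z + t * (1 - z) <= 1 by move=> *; nra.
have mono z z' : z <= z' -> z + t * (1 - z) <= z' + t * (1 - z') by move=> *; nra.
have px := pos x x0 (le_trans xx' x'1); have px' := pos x' (le_trans x0 xx') x'1.
have py := pos y y0 (le_trans yy' y'1); have py' := pos y' (le_trans y0 yy') y'1.
have := mono _ _ xx'; have := mono _ _ yy'.
move: (x + _) (x' + _) (y + _) (y' + _) px px' py py' => a a' b b' pa pa' pb pb'.
move=> bb' aa'; apply: (@le_trans _ _ (F (a', b))).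
  by move: aa'; rewrite le_eqVlt => /predU1P[->//|?]; exact/ltW/F_increasing1.
by move: bb'; rewrite le_eqVlt => /predU1P[->//|?]; exact/ltW/F_increasing2.
Qed.

(** The midpoint of [x] and [x'] is positive even if [x] is 0, so strict monotonicity applies from
    there on. *)
Lemma F_lt x x' y : 0 <= x -> x < x' -> x' <= 1 -> 0 < y <= 1 ->
  F (x, y) < F (x', y).
Proof.
move=> x0 xx' x'1 y01; apply: (@le_lt_trans _ _ (F ((x + x') / 2, y))).
  by apply: F_le; lra.
by apply: F_increasing1; lra.
Qed.

Lemma subset_neq0 U V : U `<=` V -> U !=set0 -> V !=set0.
Proof. by move=> UV [x /UV Vx]; exists x. Qed.

Lemma Bel_chain A B U : A `<=` B -> B `<=` U -> U `<=` X -> B !=set0 ->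
  Bel A U = F (Bel A B, Bel B U).
Proof.
move=> AB BU UX B0; have BX := subset_trans BU UX.
have := @Bel_conj U B A UX BX (subset_trans AB BX).
by rewrite (setIidl BU) (setIidr AB); apply.
Qed.

Let continuous11 : continuous (fun t : R * R * R => t.1.1).
Proof. by move=> t; apply: continuous_comp; exact: cvg_fst. Qed.

Let continuous12 : continuous (fun t : R * R * R => t.1.2).
Proof. by move=> t; apply: continuous_comp; [exact: cvg_fst | exact: cvg_snd]. Qed.

Let continuous2 : continuous (fun t : R * R * R => t.2).
Proof. by move=> t; exact: cvg_snd. Qed.

Let continuous_F (f g : R * R * R -> R) : continuous f -> continuous g ->
  continuous (fun t => F (f t, g t)).
Proof. exact: continuous_pair_comp. Qed.

(** On a chain, U3 itself serves as an intermediate set between U4 and U3, and it has belief 1 given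
    itself. *)
Lemma Fx1 x : 0 <= x <= 1 -> F (x, 1) = x.
Proof.
move=> x01; have z01 : 0 <= (0 : R) <= 1 by rewrite lexx ler01.
apply: (@closed_chain [set t | F (t.1.1, 1) = t.1.1] _ _ x 0 0) => //.
  apply: closed_eq_continuous; last exact: continuous11.
  by apply: continuous_F; [exact: continuous11 | move=> t; exact: cvg_cst].
move=> U1 U2 U3 U4 U1X U21 U32 U43 U3_neq0 /=.
have U3X := subset_trans U32 (subset_trans U21 U1X).
have [_ U33] := Bel_bounds U3X U3_neq0.
by rewrite [RHS](Bel_chain U43 (@subset_refl _ U3) U3X U3_neq0) U33.
Qed.

Lemma F1y y : 0 <= y <= 1 -> F (1, y) = y.
Proof.
move=> y01; have z01 : 0 <= (0 : R) <= 1 by rewrite lexx ler01.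
apply: (@closed_chain [set t | F (1, t.1.2) = t.1.2] _ _ 0 y 0) => //.
  apply: closed_eq_continuous; last exact: continuous12.
  by apply: continuous_F; [move=> t; exact: cvg_cst | exact: continuous12].
move=> U1 U2 U3 U4 U1X U21 U32 U43 U3_neq0 /=.
have U2X := subset_trans U21 U1X; have U3X := subset_trans U32 U2X.
have [_ U33] := Bel_bounds U3X U3_neq0.
by rewrite [RHS](Bel_chain (@subset_refl _ U3) U32 U2X U3_neq0) U33.
Qed.

(** On a chain, U3 serves as an intermediate set between the empty set and U2. *)
Lemma F0y y : 0 <= y <= 1 -> F (0, y) = 0.
Proof.
move=> y01; have z01 : 0 <= (0 : R) <= 1 by rewrite lexx ler01.
apply: (@closed_chain [set t | F (0, t.1.2) = 0] _ _ 0 y 0) => //.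
  apply: closed_eq_continuous; last by move=> t; exact: cvg_cst.
  by apply: continuous_F; [move=> t; exact: cvg_cst | exact: continuous12].
move=> U1 U2 U3 U4 U1X U21 U32 U43 U3_neq0 /=.
have U2X := subset_trans U21 U1X; have U3X := subset_trans U32 U2X.
have [U30 _] := Bel_bounds U3X U3_neq0.
have [U20 _] := Bel_bounds U2X (subset_neq0 U32 U3_neq0).
by rewrite -{1}U30 -(Bel_chain (@sub0set _ U3) U32 U2X U3_neq0).
Qed.

(* The assumptions leave [S] arbitrary outside of [0, 1]. *)
Definition negation x := S (clamp x).

Lemma S0 : S 0 = 1.
Proof.
have XX := @subset_refl _ X; have [X0 X1] := Bel_bounds XX X_neq0.
by rewrite -X0 -Bel_compl ?setD0//; exact: sub0set.
Qed.

Lemma S1 : S 1 = 0.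
Proof.
have XX := @subset_refl _ X; have [X0 X1] := Bel_bounds XX X_neq0.
by rewrite -X1 -Bel_compl ?setDv.
Qed.

Lemma SK U V : U `<=` X -> V `<=` X -> U !=set0 -> S (S (Bel V U)) = Bel V U.
Proof.
move=> UX VX U0; have DX : X `\` V `<=` X := @subDsetl _ _ _.
by rewrite -!Bel_compl// setDD (setIidr VX).
Qed.

Lemma negation01 x : 0 <= negation x <= 1.
Proof.
have /andP[x0 x1] := clamp01 x; rewrite /negation; apply/andP; split.
  by rewrite -S1; exact: S_decreasing.
by rewrite -S0; exact: S_decreasing.
Qed.

Lemma negation0 : negation 0 = 1.
Proof. by rewrite /negation clamp_id ?S0// lexx ler01. Qed.

Lemma negation1 : negation 1 = 0.
Proof. by rewrite /negation clamp_id ?S1// lexx ler01. Qed.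

Lemma negation_le x y : x <= y -> negation y <= negation x.
Proof. by move=> /clamp_le /S_decreasing. Qed.

Lemma negation_Bel U V : U `<=` X -> V `<=` X -> U !=set0 ->
  negation (Bel V U) = S (Bel V U).
Proof. by move=> UX VX U0; rewrite /negation clamp_id//; exact: Bel01. Qed.

(** Since [S] undoes itself on beliefs, every belief is a value of [negation]; these values are
    dense, and a monotone function with dense range cannot jump. *)
Lemma negation_continuous : continuous negation.
Proof.
have -> : negation = (fun x => 1 - (1 - negation x)).
  by apply/funext => x; rewrite opprB addrC subrK.
move=> x; apply: cvgB; first exact: cvg_cst.
move: x; apply: nondecreasing_dense_continuous.
- by move=> x y /negation_le; lra.
- by move=> x; have := negation01 x; lra.
move=> u v u0 uv v1; have z01 : 0 <= (0 : R) <= 1 by rewrite lexx ler01.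
(* The function at hand is [1 - negation]: a belief closer than half the length of the interval to 1
   minus its midpoint gives a value between [u] and [v]. *)
have [||U1 [U2 [U3 [U4 [[U1X U21 U32 U43] [U30 dU _ _]]]]]] :=
  @chains (1 - (u + v) / 2) 0 0 ((v - u) / 2) _ z01 z01; [lra | lra |].
have U3X := subset_trans U32 (subset_trans U21 U1X).
have U4X := subset_trans U43 U3X.
have DX : X `\` U4 `<=` X := @subDsetl _ _ _.
exists (S (Bel U4 U3)); rewrite -Bel_compl// negation_Bel//.
by rewrite Bel_compl// SK//; move: dU; rewrite ltr_norml; lra.
Qed.

Let continuous_N (f : R * R * R -> R) : continuous f ->
  continuous (fun t => negation (f t)).
Proof.
move=> cf t; apply: (@continuous_comp _ _ _ f negation); first exact: cf.
exact: negation_continuous.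
Qed.

Lemma negationK x : 0 <= x <= 1 -> negation (negation x) = x.
Proof.
move=> x01; have z01 : 0 <= (0 : R) <= 1 by rewrite lexx ler01.
apply: (@closed_chain [set t | negation (negation t.1.1) = t.1.1] _ _ x 0 0) => //.
  by apply: closed_eq_continuous; [do 2!apply: continuous_N|]; exact: continuous11.
move=> U1 U2 U3 U4 U1X U21 U32 U43 U3_neq0 /=.
have U3X := subset_trans U32 (subset_trans U21 U1X).
have U4X := subset_trans U43 U3X.
have DX : X `\` U4 `<=` X := @subDsetl _ _ _.
rewrite [negation (Bel _ _)]negation_Bel// -Bel_compl// negation_Bel//.
by rewrite Bel_compl// SK.
Qed.

(** * Beliefs of disjoint sets and the laws of their sums *)

Lemma Bel_cap U V : U `<=` X -> V `<=` X -> U !=set0 -> Bel (U `&` V) U = Bel V U.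
Proof.
move=> UX VX U0; have := @Bel_conj U U V UX UX VX; rewrite setIid => -> //.
by have [_ ->] := Bel_bounds UX U0; rewrite Fx1// Bel01.
Qed.

(** By [Bel_cap] the complement in [X] may be replaced by the complement in the conditioning set, as
    nested sets require. *)
Lemma Bel_diff U V : U `<=` X -> V `<=` X -> U !=set0 ->
  Bel (U `\` V) U = negation (Bel V U).
Proof.
move=> UX VX U0; rewrite negation_Bel// -Bel_compl// -(@Bel_cap U (X `\` V))//.
  by rewrite setIDA (setIidl UX).
Qed.

Lemma Bel_disjoint_sum U A B : U `<=` X -> U !=set0 -> A `<=` U -> B `<=` U ->
  A `&` B = set0 ->
  disjoint_sum F negation (Bel A U) (Bel B U) (Bel (A `|` B) U).
Proof.
move=> UX U0 AU BU AB; have AX := subset_trans AU UX; have BX := subset_trans BU UX.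
have ABU : A `|` B `<=` U by rewrite subUset.
(* If [A] is all of [U], conditioning on the difference is impossible; then [B] is empty and the
   parameter 1 serves. Otherwise the parameter is the belief of [B] given the difference. *)
have [|/eqP/set0P UA0] := pselect (U `\` A = set0).
  rewrite setD_eq0 => UA; have AE : A = U by apply/seteqP.
  have BE : B = set0 by rewrite -AB AE (setIidr BU).
  have [Bel0 Bel1] := Bel_bounds UX U0; rewrite AE BE setU0 Bel0 Bel1.
  exists 1; rewrite lexx ler01 negation1 !F1y ?F0y ?lexx ?ler01//.
  by rewrite negation0.
have BUA : B `<=` U `\` A.
  by move=> x Bx; split; [exact: BU | move=> Ax; have : set0 x by rewrite -AB].
have UAU : U `\` A `<=` U by exact: subDsetl.
have UAX := subset_trans UAU UX.
exists (Bel B (U `\` A)); split; [exact: Bel01 | exact: Bel01 | |].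
  by rewrite -Bel_diff// -Bel_chain.
have DA : U `\` A `\` B `<=` U `\` A := @subDsetl _ _ _.
have DU := subset_trans DA UAU; have DX := subset_trans DU UX.
rewrite -!Bel_diff// -Bel_chain// -Bel_diff//.
by rewrite setDDl setDD (setIidr ABU).
Qed.

Let closed_sum (f g h : R * R * R -> R) :
  continuous f -> continuous g -> continuous h ->
  closed [set t | disjoint_sum F negation (f t) (g t) (h t)].
Proof.
move=> cf cg ch.
apply: (@preimage_closed _ _ (fun t => (f t, g t, h t))
  [set t | disjoint_sum F negation t.1.1 t.1.2 t.2]).
  move=> t _; apply: (@continuous_pair_comp _ _ _ _ _ _ id) => //.
    by move=> q; exact: cvg_id.
  by apply: (@continuous_pair_comp _ _ _ _ _ _ id) => // q; exact: cvg_id.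
by apply: disjoint_sum_closed; last exact: negation_continuous.
Qed.

Ltac continuity := repeat first
  [ exact: continuous11 | exact: continuous12 | exact: continuous2
  | apply: continuous_F | apply: continuous_N ].

(** On a chain these are the beliefs in U1 of U3, of the complement of U2 and of their union. *)
Lemma sum_sym_law beta gamma : 0 <= beta <= 1 -> 0 <= gamma <= 1 ->
  disjoint_sum F negation (F (beta, gamma)) (negation gamma)
    (negation (F (negation beta, gamma))).
Proof.
move=> b01 c01; have z01 : 0 <= (0 : R) <= 1 by rewrite lexx ler01.
apply: (@closed_chain [set t | disjoint_sum F negation (F (t.1.2, t.2))
  (negation t.2) (negation (F (negation t.1.2, t.2)))] _ _ 0) => //.
  by apply: closed_sum; continuity.
move=> U1 U2 U3 U4 U1X U21 U32 U43 U3_neq0 /=.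
have U2_neq0 := subset_neq0 U32 U3_neq0; have U1_neq0 := subset_neq0 U21 U2_neq0.
have U2X := subset_trans U21 U1X; have U3X := subset_trans U32 U2X.
have U31 := subset_trans U32 U21.
have D2 : U2 `\` U3 `<=` U2 := @subDsetl _ _ _.
have D21 := subset_trans D2 U21; have D2X := subset_trans D2 U2X.
rewrite -Bel_chain// -!Bel_diff// -Bel_chain// -Bel_diff//.
rewrite setDDr (setIidr U31) setUC; apply: Bel_disjoint_sum => //.
by rewrite setIDA (setIidl U31); rewrite setD_eq0.
Qed.

(** On a chain, the three disjoint sets U1 minus U2, U2 minus U3 and U4 are united in two ways,
    grouping the first two or the last two. *)
Lemma sum_assoc_law alpha beta gamma :
  0 <= alpha <= 1 -> 0 <= beta <= 1 -> 0 <= gamma <= 1 ->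
  disjoint_sum F negation (negation (F (beta, gamma))) (F (F (alpha, beta), gamma))
    (negation (F (F (negation alpha, beta), gamma))) /\
  disjoint_sum F negation (negation gamma)
    (F (negation (F (negation alpha, beta)), gamma))
    (negation (F (F (negation alpha, beta), gamma))).
Proof.
move=> a01 b01 c01.
apply: (@closed_chain [set t |
  disjoint_sum F negation (negation (F (t.1.2, t.2))) (F (F (t.1.1, t.1.2), t.2))
    (negation (F (F (negation t.1.1, t.1.2), t.2))) /\
  disjoint_sum F negation (negation t.2)
    (F (negation (F (negation t.1.1, t.1.2)), t.2))
    (negation (F (F (negation t.1.1, t.1.2), t.2)))]) => //.
  by apply: closedI; apply: closed_sum; continuity.
move=> U1 U2 U3 U4 U1X U21 U32 U43 U3_neq0 /=.
have U2_neq0 := subset_neq0 U32 U3_neq0; have U1_neq0 := subset_neq0 U21 U2_neq0.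
have U2X := subset_trans U21 U1X; have U3X := subset_trans U32 U2X.
have U31 := subset_trans U32 U21; have U4X := subset_trans U43 U3X.
have U42 := subset_trans U43 U32; have U41 := subset_trans U42 U21.
have D3 : U3 `\` U4 `<=` U3 := @subDsetl _ _ _.
have D32 := subset_trans D3 U32; have D31 := subset_trans D3 U31.
have D3X := subset_trans D3 U3X.
have D2 : U2 `\` (U3 `\` U4) `<=` U2 := @subDsetl _ _ _.
have D21 := subset_trans D2 U21.
rewrite -!Bel_chain// -!Bel_diff// -!Bel_chain// -!Bel_diff// -!Bel_chain//.
have -> : U1 `\` (U3 `\` U4) = (U1 `\` U3) `|` U4 by rewrite setDDr (setIidr U41).
split.
  apply: Bel_disjoint_sum => //.
  by rewrite setIC setIDA (setIidl U41); rewrite setD_eq0.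
have -> : (U1 `\` U3) `|` U4 = (U1 `\` U2) `|` (U2 `\` (U3 `\` U4)).
  rewrite setDDr (setIidr U42) setUA; congr (_ `|` _).
  apply/seteqP; split=> x /=.
    by move=> [U1x U3x]; have [U2x|U2x] := pselect (U2 x); [right|left].
  by move=> [[U1x U2x]|[U2x U3x]]; split=> //; [move/U32 | exact: U21].
apply: Bel_disjoint_sum => //.
by apply/seteqP; split=> x //= [[_ U2x] [/U2x]].
Qed.

(** On a chain, the disjoint subsets U2 minus U3 and U4 of U2 are united and seen from U1; the
    factor [gamma] leads from U2 to U1. *)
Lemma sum_dist_law alpha beta gamma :
  0 <= alpha <= 1 -> 0 <= beta <= 1 -> 0 <= gamma <= 1 ->
  disjoint_sum F negation (F (negation beta, gamma)) (F (F (alpha, beta), gamma))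
    (F (negation (F (negation alpha, beta)), gamma)).
Proof.
move=> a01 b01 c01.
apply: (@closed_chain [set t |
  disjoint_sum F negation (F (negation t.1.2, t.2)) (F (F (t.1.1, t.1.2), t.2))
    (F (negation (F (negation t.1.1, t.1.2)), t.2))]) => //.
  by apply: closed_sum; continuity.
move=> U1 U2 U3 U4 U1X U21 U32 U43 U3_neq0 /=.
have U2_neq0 := subset_neq0 U32 U3_neq0; have U1_neq0 := subset_neq0 U21 U2_neq0.
have U2X := subset_trans U21 U1X; have U3X := subset_trans U32 U2X.
have U31 := subset_trans U32 U21; have U4X := subset_trans U43 U3X.
have U42 := subset_trans U43 U32; have U41 := subset_trans U42 U21.
have D3 : U3 `\` U4 `<=` U3 := @subDsetl _ _ _.
have D32 := subset_trans D3 U32; have D3X := subset_trans D3 U3X.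
have D2 : U2 `\` U3 `<=` U2 := @subDsetl _ _ _.
have D21 := subset_trans D2 U21.
have D2' : U2 `\` (U3 `\` U4) `<=` U2 := @subDsetl _ _ _.
have D2'1 := subset_trans D2' U21.
rewrite -!Bel_diff// -!Bel_chain// -!Bel_diff// -!Bel_chain//.
rewrite setDDr (setIidr U42); apply: Bel_disjoint_sum => //.
by apply/seteqP; split=> x //= [[_ U3x] /U43 /U3x].
Qed.

(** Any nonempty [Y] can serve as the certain event, since sums and conjunctions are taken
    conditionally on [Y]. This covers both sets of worlds of the theorem. *)
Lemma isomorphic_to_probability_subsets Y : Y `<=` X -> Y !=set0 ->
  isomorphic_to_probability Y Bel.
Proof.
move=> YX Y0; have [g [cg bg [g_ge0 g1] gM gD]] := probability_scale_exists
  F_continuous negation_continuous F_le F_lt F1y F0y negation01 negation_le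
  negationK negation0 negation1 sum_sym_law sum_assoc_law sum_dist_law.
have YY := @subset_refl _ Y.
exists g; split=> //.
  split.
  - by move=> U UY; apply: g_ge0; apply: Bel01 => //; exact: subset_trans YX.
  - by have [_ ->] := Bel_bounds YX Y0.
  - by move=> U V UY VY UV; apply/esym/gD; exact: Bel_disjoint_sum.
move=> U V UY VY U0.
have UX := subset_trans UY YX; have VX := subset_trans VY YX.
rewrite -gM; [|exact: Bel01|exact: Bel01].
have := @Bel_conj Y U V YX UX VX; rewrite (setIidl UY) setIC => -> //.
Qed.

End Belief.

Theorem theorem4 (R : realType) (T : Type) (W Wp : set T)
    (Bel Belp : set T -> set T -> R) (S : R -> R) (F : R * R -> R)
    (W_neq0 : W !=set0)
    (W_sub_Wp : W `<=` Wp)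
    (Belp_extends : forall U V, U `<=` W -> V `<=` W -> U !=set0 ->
      Belp V U = Bel V U)
    (A1 : forall U V, U `<=` Wp -> V `<=` Wp -> U !=set0 ->
      Belp (Wp `\` V) U = S (Belp V U))
    (A2 : forall U V V', U `<=` Wp -> V `<=` Wp -> V' `<=` Wp ->
      V `&` U !=set0 ->
      Belp (V `&` V') U = F (Belp V' (V `&` U), Belp V U))
    (Par1 : forall U V, U `<=` Wp -> V `<=` Wp -> U !=set0 ->
      0 <= Belp V U <= 1)
    (Par2 : forall U, U `<=` Wp -> U !=set0 ->
      Belp set0 U = 0 /\ Belp U U = 1)
    (Par3 : forall x y, x <= y -> S y <= S x)
    (Par4_continuous : continuous F)
    (Par4_increasing1 : forall x x' y, 0 < x <= 1 -> 0 < x' <= 1 ->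
      0 < y <= 1 -> x < x' -> F (x, y) < F (x', y))
    (Par4_increasing2 : forall x y y', 0 < x <= 1 -> 0 < y <= 1 ->
      0 < y' <= 1 -> y < y' -> F (x, y) < F (x, y'))
    (Par5 : forall alpha beta gamma epsilon : R,
      0 <= alpha <= 1 -> 0 <= beta <= 1 -> 0 <= gamma <= 1 -> 0 < epsilon ->
      exists U1 U2 U3 U4 : set T,
        [/\ U1 `<=` Wp, U2 `<=` U1, U3 `<=` U2 & U4 `<=` U3] /\
        [/\ U3 !=set0,
            `|Belp U4 U3 - alpha| < epsilon,
            `|Belp U3 U2 - beta| < epsilon
          & `|Belp U2 U1 - gamma| < epsilon]) :
  isomorphic_to_probability Wp Belp /\ isomorphic_to_probability W Bel.
Proof.
have Wp_neq0 : Wp !=set0 := subset_neq0 W_sub_Wp W_neq0.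
have iso := isomorphic_to_probability_subsets Wp_neq0 A1 A2 Par1 Par2 Par3
  Par4_continuous Par4_increasing1 Par4_increasing2 Par5.
split; first exact: iso.
(* Relative to [W] only beliefs of subsets of [W] given [W] or one of its nonempty subsets occur,
   and there [Belp] agrees with [Bel]. *)
have [g [cg bg [g_ge0 g1 gD] gM]] := iso W W_sub_Wp W_neq0.
have W_refl := @subset_refl _ W.
exists g; split=> //.
  split.
  - by move=> U UW; rewrite -Belp_extends//; exact: g_ge0.
  - by rewrite -Belp_extends.
  - move=> U V UW VW UV; rewrite -!Belp_extends//; first exact: gD.
    by rewrite subUset.
move=> U V UW VW U0; rewrite -!Belp_extends//; first exact: gM.
exact: subset_trans (@subIsetl _ _ _) VW.
Qed.
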